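(* Let $k,\ell$ be positive integers, let $t\ge2$ be an integer and $c>0$ a real number, and let $\theta$ be the second largest eigenvalue of the matrix $B(k,\ell,2t,c)$. Then every finite $(k,\ell)$-semiregular bipartite graph whose adjacency matrix has second largest eigenvalue at most $\theta$ has at most $$1+k\sum_{i=1}^{t-2}(\ell-1)^i(k-1)^{i-1}+\frac{k(\ell-1)^{t-1}(k-1)^{t-2}}{c}$$ vertices of valency $k$. That is, $b(k,\ell,\theta)$ is at most this quantity.
   Context: A $(k,\ell)$-semiregular bipartite graph is a bipartite graph with parts $B,C$ where every vertex of $B$ has valency $k$ and every vertex of $C$ has valency $\ell$; $b(k,\ell,\theta)$ denotes the maximum number of vertices of valency $k$ in a $(k,\ell)$-semiregular bipartite graph with second largest adjacency eigenvalue at most $\theta$. For an integer $m\ge4$ and real $c$, $B(k,\ell,m,c)$ is the $m\times m$ tridiagonal matrix with zero main diagonal, subdiagonal entries $(B_{2,1},\dots,B_{m,m-1})=(1,\dots,1,c,e)$ where $e=k$ if $m$ is odd and $e=\ell$ if $m$ is even, and superdiagonal entries chosen so that the $i$-th row sum is $k$ for $i$ odd and $\ell$ for $i$ even. For $m=2t$ this is $$\begin{pmatrix}0&k\\1&0&\ell-1\\&1&0&k-1\\&&\ddots&\ddots&\ddots\\&&&1&0&\ell-1\\&&&&c&0&k-c\\&&&&&\ell&0\end{pmatrix}.$$ *)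

(* Defs.v *)
From mathcomp Require Import all_boot all_order all_algebra.
From mathcomp Require Import reals.
Set Implicit Arguments.
Unset Strict Implicit.
Unset Printing Implicit Defensive.
Import Order.TTheory GRing.Theory Num.Theory.
Local Open Scope ring_scope.

(* [s] lists the real eigenvalues of [A] in nonincreasing order, each repeated
   according to its algebraic multiplicity; such an [s] exists and is unique.
   Nonreal eigenvalues, which [A] may have when it is not symmetric, are not
   listed. *)
Definition ordered_eigenvalues (R : realType) (n : nat) (A : 'M[R]_n)
    (s : seq R) : Prop :=
  sorted >=%R s /\ forall x : R, count_mem x s = mup x (char_poly A).

(* There is no such [theta] when [A] has fewer than two real eigenvalues, e.g.
   for the adjacency matrix of the graph without vertices. *)
Definition second_largest_eigenvalue (R : realType) (n : nat) (A : 'M[R]_n)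
    (theta : R) : Prop :=
  exists s : seq R,
    [/\ ordered_eigenvalues A s, (1 < size s)%N & s`_1 = theta].

Definition valency (V : finType) (adj : rel V) (x : V) : nat :=
  #|[set y | adj x y]|.

Definition adjacency_matrix (R : realType) (V : finType) (adj : rel V) :
    'M[R]_#|V| :=
  \matrix_(i, j) (adj (enum_val i) (enum_val j))%:R.

(* The parts are [B] and [C := ~: B]. *)
Definition semiregular_bipartite (k l : nat) (V : finType) (adj : rel V)
    (B : {set V}) : Prop :=
  [/\ symmetric adj,
      irreflexive adj,
      forall x y, adj x y -> (x \in B) != (y \in B),
      forall x, x \in B -> valency adj x = k
    & forall x, x \notin B -> valency adj x = l].

Definition second_eigenvalue_le (R : realType) (V : finType) (adj : rel V)
    (theta : R) : Prop :=
  exists2 lambda : R,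
    second_largest_eigenvalue (adjacency_matrix R adj) lambda
    & lambda <= theta.

(* [b(k, l, theta) = n]. When k = l the vertices "of valency k" that are counted
   are those of the part B only. *)
Definition is_b (R : realType) (k l : nat) (theta : R) (n : nat) : Prop :=
  (exists (V : finType) (adj : rel V) (B : {set V}),
     [/\ semiregular_bipartite k l adj B,
         second_eigenvalue_le adj theta
       & #|B| = n])
  /\ (forall (V : finType) (adj : rel V) (B : {set V}),
        semiregular_bipartite k l adj B ->
        second_eigenvalue_le adj theta ->
        (#|B| <= n)%N).

(* Rows and columns are numbered from 0 below, so the usual row i is row i - 1
   here and the parities of row numbers are exchanged. *)
Definition Bmx_row_sum (R : realType) (k l i : nat) : R :=
  if odd i then l%:R else k%:R.

(* The entry in row [i] just left of the diagonal, and 0 in the first row. *)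
Definition Bmx_sub (R : realType) (k l m : nat) (c : R) (i : nat) : R :=
  if i == 0%N then 0
  else if i.+1 == m then (if odd m then k%:R else l%:R)
  else if i.+2 == m then c
  else 1.

Definition Bmx (R : realType) (k l m : nat) (c : R) : 'M[R]_m :=
  \matrix_(i < m, j < m)
    if i == j.+1 :> nat then Bmx_sub k l m c i
    else if j == i.+1 :> nat then Bmx_row_sum R k l i - Bmx_sub k l m c i
    else 0.

(* Main.v *)
(** Let A be the adjacency matrix. For x in B the entries (x, y) of
    [ball k l (A ^+ 2) j] count the nonbacktracking walks from x to y of even
    length at most 2j, and the characteristic polynomial of [Bmx] is
    (X^2 - kl) P(X^2) with P = [endpoly] = ball_(n+1) + (c - 1) ball_n, n = t - 2.
    If mu is the largest root of P, then Christoffel-Darboux gives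
    ball_n(mu) P(x) = (x - mu) K(x) with K = sum_j q^(n-j) ball_j(mu) ball_j(x),
    q = (k-1)(l-1), so that P K <= 0 on the squares of all eigenvalues of A other
    than +/- sqrt(kl); hence the trace of (P K)(A^2) over B is at most P(kl) K(kl).
    Since walk counts are natural numbers that increase with j, each diagonal
    entry of (P K)(A^2) over B is at least c K(kl), whence #|B| <= P(kl) / c,
    which is the claimed bound. The degenerate cases k = 1, l = 1 and mu < 0
    are reduced to the same trace estimate with other parameters. *)
Require Import Defs.
From mathcomp Require Import all_boot all_order all_algebra.
From mathcomp Require Import reals.
From mathcomp Require Import complex polyrcf sesquilinear spectral ring lra zify.
Import Order.TTheory GRing.Theory Num.Theory.
Local Open Scope ring_scope.

(** * The polynomials counting walks in a ball *)

(** The ring is arbitrary so that [x] can be a number, ['X] or ['X^2]. The first step is irregular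
    because A^2 has diagonal entries k on [B]: A^2 - k counts the nonbacktracking walks of length 2,
    and + 1 the empty walk. *)
Fixpoint ball {T : comNzRingType} (k l : nat) (x : T) (j : nat) : T :=
  match j with
  | 0 => 1
  | j'.+1 =>
      match j' with
      | 0 => x - k%:R + 1
      | j''.+1 => (x - (k%:R + l%:R - 2%:R)) * ball k l x j'
                  - (k%:R - 1) * (l%:R - 1) * ball k l x j''
      end
  end.

Arguments ball : simpl never.

Lemma ball0 {T : comNzRingType} k l (x : T) : ball k l x 0 = 1.
Proof. by []. Qed.

Lemma ball1 {T : comNzRingType} k l (x : T) : ball k l x 1 = x - k%:R + 1.
Proof. by []. Qed.

Lemma ballSS {T : comNzRingType} k l (x : T) j :
  ball k l x j.+2 = (x - (k%:R + l%:R - 2%:R)) * ball k l x j.+1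
                    - (k%:R - 1) * (l%:R - 1) * ball k l x j.
Proof. by []. Qed.

Lemma rmorph_ball {T U : comNzRingType} (f : {rmorphism T -> U}) k l x j :
  f (ball k l x j) = ball k l (f x) j.
Proof.
elim/ltn_ind: j => -[|[|j]] IH; first exact: rmorph1.
  by rewrite !ball1 rmorphD rmorphB rmorph1 rmorph_nat.
rewrite !ballSS rmorphB !rmorphM !IH //; congr (_ * _ - _ * _);
  by rewrite ?rmorphM !rmorphB ?rmorphD ?rmorph_nat ?rmorph1 ?rmorphM1.
Qed.

Lemma horner_ball {R : comNzRingType} k l (x : R) j :
  (ball k l 'X j).[x] = ball k l x j.
Proof. by rewrite -horner_evalE rmorph_ball /= horner_evalE hornerX. Qed.

Lemma size_ball {R : idomainType} k l j :
  size (ball k l ('X : {poly R}) j) = j.+1 /\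
  ball k l ('X : {poly R}) j \is monic.
Proof.
elim/ltn_ind: j => -[|[|j]] IH; first by rewrite size_poly1 monic1.
  have -> : ball k l 'X 1 = 'X - (k%:R - 1 : R)%:P.
    by rewrite ball1 polyCB polyC_natr polyC1; ring.
  by rewrite size_XsubC monicXsubC.
have [s1 m1] := IH j.+1 (ltnSn _); have [s0 m0] := IH j (leqnSn _).
rewrite ballSS.
have -> : (k%:R + l%:R - 2%:R : {poly R}) = (k%:R + l%:R - 2%:R)%:P.
  by rewrite polyCB polyCD !polyC_natr.
have -> : ((k%:R - 1) * (l%:R - 1) : {poly R}) = ((k%:R - 1) * (l%:R - 1))%:P.
  by rewrite polyCM !polyCB !polyC_natr polyC1.
set a := _ - 2%:R; set q := _ * (_ - 1).
have sz1 : size (('X - a%:P) * ball k l 'X j.+1) = j.+3.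
  by rewrite size_monicM ?monicXsubC ?monic_neq0 // size_XsubC s1.
have lt : (size (- (q%:P * ball k l 'X j))%R < size (('X - a%:P) * ball k l 'X j.+1)%R)%N.
  rewrite size_polyN sz1 mul_polyC.
  by apply: leq_ltn_trans (size_scale_leq _ _) _; rewrite s0.
split; first by rewrite size_polyDl.
by rewrite monicE lead_coefDl // lead_coef_monicM ?monicXsubC // (monicP m1).
Qed.

Definition endpoly {T : comNzRingType} (k l n : nat) (c x : T) : T :=
  ball k l x n.+1 + (c - 1) * ball k l x n.

Definition endpolyX {R : idomainType} (k l n : nat) (c : R) : {poly R} :=
  endpoly k l n c%:P 'X.

Lemma horner_endpolyX {R : idomainType} k l n (c x : R) :
  (endpolyX k l n c).[x] = endpoly k l n c x.
Proof. by rewrite hornerD hornerM !horner_ball hornerD hornerN !hornerC. Qed.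

Lemma size_endpolyX {R : idomainType} k l n (c : R) :
  size (endpolyX k l n c) = n.+2 /\ endpolyX k l n c \is monic.
Proof.
have [s1 m1] := @size_ball R k l n.+1; have [s0 _] := @size_ball R k l n.
rewrite /endpolyX /endpoly -polyC1 -polyCB mul_polyC.
have lt : (size ((c - 1) *: ball k l 'X n)%R < size (ball k l ('X : {poly R}) n.+1)%R)%N.
  by rewrite s1; apply: leq_ltn_trans (size_scale_leq _ _) _; rewrite s0.
split; first by rewrite size_polyDl.
by rewrite monicE lead_coefDl // (monicP m1).
Qed.

(* Holds for every such three-term recurrence as soon as ball_1(x) - ball_1(y) = x - y. *)
Lemma christoffel_darboux {T : comNzRingType} k l (x y : T) n :
  ball k l x n.+1 * ball k l y n - ball k l x n * ball k l y n.+1 =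
  (x - y) * \sum_(j < n.+1)
    ((k%:R - 1) * (l%:R - 1)) ^+ (n - j) * ball k l y j * ball k l x j.
Proof.
elim: n => [|n IH]; first by rewrite big_ord_recl big_ord0 !ball1 !ball0 expr0; ring.
rewrite big_ord_recr /= subnn expr0 mul1r.
have -> : \sum_(i < n.+1) ((k%:R - 1) * (l%:R - 1)) ^+ (n.+1 - i)
            * ball k l y i * ball k l x i =
   ((k%:R - 1) * (l%:R - 1)) * \sum_(j < n.+1)
    ((k%:R - 1) * (l%:R - 1)) ^+ (n - j) * ball k l y j * ball k l x j.
  rewrite big_distrr; apply: eq_bigr => i _ /=.
  by rewrite subSn 1?leq_ord // exprS -!mulrA.
move: IH; set s := \sum_(j < n.+1) _ => IH.
transitivity ((k%:R - 1) * (l%:R - 1) * ((x - y) * s)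
              + (x - y) * (ball k l y n.+1 * ball k l x n.+1)); last by ring.
by rewrite -IH !ballSS; ring.
Qed.

Definition kernel_poly {T : comNzRingType} (k l n : nat) (mu x : T) : T :=
  \sum_(j < n.+1)
    ((k%:R - 1) * (l%:R - 1)) ^+ (n - j) * ball k l mu j * ball k l x j.

(** At a root [mu] of P one has ball_(n+1)(mu) = -(c - 1) ball_n(mu), which turns the left side of
    [christoffel_darboux] into P(x) ball_n(mu). *)
Lemma endpoly_kernel {T : comNzRingType} k l n (c mu x : T) :
  endpoly k l n c mu = 0 ->
  endpoly k l n c x * ball k l mu n = (x - mu) * kernel_poly k l n mu x.
Proof.
move=> mu0; rewrite -christoffel_darboux.
have -> : ball k l mu n.+1 = - ((c - 1) * ball k l mu n).
  by apply/eqP; rewrite -addr_eq0; apply/eqP.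
by rewrite /endpoly; ring.
Qed.

(** * Growth of the ball polynomials from kl on, and the largest root of [endpoly] *)

Section Positivity.
Context {R : rcfType} (k l : nat).
Hypotheses (k_gt0 : (0 < k)%N) (l_gt0 : (0 < l)%N).

(** With u and v the values at j + 1 and j, the next increment is (x - kl) u + (k-1)(l-1)(u - v), so
    growth propagates by induction. *)
Lemma ball_ge (x : R) j : (k * l)%:R <= x ->
  1 <= ball k l x j <= ball k l x j.+1.
Proof.
have k1 : 1 <= k%:R :> R by rewrite ler1n.
have l1 : 1 <= l%:R :> R by rewrite ler1n.
rewrite natrM => xkl; elim: j => [|j /andP[s1 s2]]; first by rewrite ball1 ball0; nra.
rewrite (le_trans s1 s2) ballSS -subr_ge0.
move: s1 s2; set u := ball _ _ _ j.+1; set v := ball _ _ _ j => s1 s2 /=.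
have -> : (x - (k%:R + l%:R - 2%:R)) * u - (k%:R - 1) * (l%:R - 1) * v - u
  = (x - k%:R * l%:R) * u + (k%:R - 1) * (l%:R - 1) * (u - v) by ring.
by rewrite addr_ge0 ?mulr_ge0 ?subr_ge0 // (le_trans _ s2) // (le_trans _ s1).
Qed.

Lemma endpoly_gt0 n (c x : R) : 0 < c -> (k * l)%:R <= x ->
  0 < endpoly k l n c x.
Proof. by move=> c0 /(@ball_ge _ n) /andP[]; rewrite /endpoly; nra. Qed.

(** At kl the increments count the nonbacktracking walks of length 2(j+1) from a vertex of valency
    k: k(l-1) of length 2, then a factor (k-1)(l-1) for every two further steps. *)
Lemma ball_shell j :
  ball k l (k * l)%:R j.+1 - ball k l (k * l)%:R j =
  k%:R * (l%:R - 1) * ((k%:R - 1) * (l%:R - 1)) ^+ j :> R.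
Proof.
elim: j => [|j IH]; first by rewrite ball1 ball0 natrM expr0; ring.
by rewrite exprS mulrCA -IH ballSS natrM; ring.
Qed.

Lemma ball_sum n :
  ball k l (k * l)%:R n =
  1 + \sum_(i < n) k%:R * (l%:R - 1) * ((k%:R - 1) * (l%:R - 1)) ^+ i :> R.
Proof.
elim: n => [|n IH]; first by rewrite big_ord0 addr0.
by rewrite big_ord_recr /= addrA -IH -ball_shell addrC subrK.
Qed.

(** P(kl) splits as c ball_n + (ball_(n+1) - ball_n): after division by c the first part is 1 plus
    the sum, and the increment is the last term. *)
Lemma endpoly_bound n (c : R) : 0 < c ->
  endpoly k l n c (k * l)%:R / c =
  1 + k%:R * (\sum_(1 <= i < n.+1) (l%:R - 1) ^+ i * (k%:R - 1) ^+ (i - 1))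
    + k%:R * (l%:R - 1) ^+ n.+1 * (k%:R - 1) ^+ n / c.
Proof.
move=> c0; have cN0 : c != 0 by rewrite gt_eqF.
have -> : endpoly k l n c (k * l)%:R =
   c * ball k l (k * l)%:R n + (ball k l (k * l)%:R n.+1 - ball k l (k * l)%:R n).
  by rewrite /endpoly; ring.
rewrite mulrDl mulrAC mulfV // mul1r ball_shell ball_sum; congr (_ + _ + _).
  rewrite big_add1 /= big_mkord big_distrr; apply: eq_bigr => i _ /=.
  by rewrite exprMn exprS subn1 /=; ring.
by rewrite exprMn exprS; ring.
Qed.

(** The witness is the largest element among [r] and the real roots: beyond it p has no root, hence
    the sign of its leading coefficient, and p(r) < 0 prevents it from being [r]. *)
Lemma monic_largest_root (p : {poly R}) (r : R) : p \is monic -> p.[r] < 0 ->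
  exists mu, [/\ r < mu, p.[mu] = 0 & forall x, mu < x -> 0 < p.[x]].
Proof.
move=> pm pr; have p0 := monic_neq0 pm.
have noroot_pos x : (forall y, x <= y -> ~~ root p y) -> 0 < p.[x].
  move=> nr; rewrite -sgr_cp0 (@sgp_pinftyP _ x) ?in_itv /= ?lexx //.
    by rewrite /sgp_pinfty (monicP pm) sgr1.
  by move=> y; rewrite in_itv andbT => /nr.
have [m] : exists2 m, m \in r :: rootsR p & {in r :: rootsR p, forall y, y <= m}.
  elim: (rootsR p) r {pr noroot_pos} => [|y s IH] r.
    by exists r => [|y]; rewrite inE // => /eqP ->.
  have [m mem mle] := IH (Num.max r y); exists m.
    move: mem; rewrite !inE => /orP[/eqP ->|->]; last by rewrite !orbT.
    by case: leP => _; rewrite eqxx ?orbT.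
  have := mle _ (mem_head _ _); rewrite ge_max => /andP[rm ym] z.
  rewrite !inE => /or3P[/eqP ->|/eqP ->|zs] //.
  by apply: mle; rewrite inE zs orbT.
move=> mem mle; have pos x : m < x -> 0 < p.[x].
  move=> mx; apply: noroot_pos => y xy; apply: contraL (lt_le_trans mx xy) => ry.
  by rewrite -leNgt mle // inE -roots_on_rootsR // ry orbT.
have mr : m != r.
  apply/eqP => mr; have := pr; rewrite ltNge ltW // noroot_pos // => y.
  rewrite le_eqVlt => /orP[/eqP <-|ry].
    by apply: contraTN pr => /rootP ->; rewrite ltxx.
  by apply/negP => /rootP py; have := pos y; rewrite mr py ltxx => /(_ ry).
exists m; split=> //; first by rewrite lt_neqAle eq_sym mr mle ?mem_head.
by move: mem; rewrite inE (negPf mr) -roots_on_rootsR // => /rootP.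
Qed.

(** Interlacing, with q = (k-1)(l-1) > 0. At the largest root r of ball_(n+1), which is [endpoly]
    with parameter 1, the recurrence gives ball_(n+2)(r) = -q ball_n(r) < 0. Hence, for every [d],
    the next [endpoly] is negative at r and its largest root lies to the right of r. *)
Lemma largest_root n (d : R) : (n == 0%N) || ((1 < k) && (1 < l))%N ->
  exists mu, [/\ endpoly k l n d mu = 0,
    forall x, mu < x -> 0 < endpoly k l n d x
    & forall x j, mu <= x -> (j <= n)%N -> 0 < ball k l x j].
Proof.
move=> hn; elim: n d hn => [|n IH] d hn.
  exists (k%:R - d); split=> [|x|x j _]; first by rewrite /endpoly ball1 ball0; ring.
    by rewrite /endpoly ball1 ball0; lra.
  by rewrite leqn0 => /eqP ->; rewrite ltr01.
have k1 : 1 < k%:R :> R by rewrite ltr1n; case/andP: hn.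
have l1 : 1 < l%:R :> R by rewrite ltr1n; case/andP: hn.
have [r [r0 rpos rball]] : exists r : R, [/\ endpoly k l n 1 r = 0,
    forall x, r < x -> 0 < endpoly k l n 1 x
    & forall x j, r <= x -> (j <= n)%N -> 0 < ball k l x j].
  by apply: IH; rewrite [X in _ || X]hn orbT.
have e1 x : endpoly k l n 1 x = ball k l x n.+1.
  by rewrite /endpoly subrr mul0r addr0.
have neg : (endpolyX k l n.+1 d).[r] < 0.
  rewrite horner_endpolyX /endpoly -e1 r0 mulr0 addr0 ballSS -e1 r0 mulr0 sub0r.
  by rewrite oppr_lt0 !mulr_gt0 ?subr_gt0 // rball.
have [mu [rmu mu0 mupos]] := monic_largest_root _ _ (size_endpolyX k l n.+1 d).2 neg.
exists mu; split=> [|x /mupos|x j mux]; rewrite -?horner_endpolyX //.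
have rx := lt_le_trans rmu mux.
by rewrite leq_eqVlt => /orP[/eqP->|/ltnSE jn]; [rewrite -e1 rpos|rewrite rball // ltW].
Qed.

End Positivity.

(** * The characteristic polynomial of [Bmx] *)

(* As a polynomial in the adjacency matrix: nonbacktracking walks whose length is
   at most [j] and has the parity of [j]. *)
Fixpoint walk {T : comNzRingType} (k l : nat) (x : T) (j : nat) : T :=
  match j with
  | 0 => 1
  | j'.+1 =>
      match j' with
      | 0 => x
      | j''.+1 => x * walk k l x j' - ((if odd j'' then l else k)%:R - 1) * walk k l x j''
      end
  end.
Arguments walk : simpl never.

Lemma walk0 {T : comNzRingType} k l (x : T) : walk k l x 0 = 1.
Proof. by []. Qed.

Lemma walk1 {T : comNzRingType} k l (x : T) : walk k l x 1 = x.
Proof. by []. Qed.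

Lemma walkSS {T : comNzRingType} k l (x : T) j :
  walk k l x j.+2 =
  x * walk k l x j.+1 - ((if odd j then l else k)%:R - 1) * walk k l x j.
Proof. by []. Qed.

Lemma walk_ball {T : comNzRingType} k l (x : T) i :
  walk k l x i.*2 = ball k l (x ^+ 2) i.
Proof.
elim/ltn_ind: i => -[|[|i]] IH //.
  by rewrite /= walkSS walk0 walk1 ball1 /=; ring.
rewrite ballSS -!IH // !doubleS !walkSS /= !negbK odd_double /=.
by ring.
Qed.

Lemma sum_ord_eq {T : nmodType} (m p : nat) (a : nat -> T) :
  \sum_(j < m) (if j == p :> nat then a j else 0) = if (p < m)%N then a p else 0.
Proof. by rewrite -big_mkcond big_ord1_eq. Qed.

Lemma sum_even {T : nmodType} (f : nat -> T) j :
  \sum_(i < j.*2) (if odd i then 0 else f i) = \sum_(i < j) f i.*2.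
Proof.
elim: j => [|j IH]; first by rewrite !big_ord0.
by rewrite doubleS !big_ord_recr /= odd_double /= addr0 IH.
Qed.

Section CharPoly.
Context {R : realType} (k l n : nat) (c : R).
Hypotheses (l_gt0 : (0 < l)%N) (c_gt0 : 0 < c).

Let m := (2 * n.+2)%N.
Let sub (i : nat) := Bmx_sub k l m c i.
Let rsum (i : nat) : R := Bmx_row_sum R k l i.

(** The boundary rows fit the same formula: [sub 0] is 0, and in the last row, whose index is odd,
    the row sum and the subdiagonal entry are both l. *)
Lemma Bmx_mulr (w : nat -> {poly R}) (i : 'I_m) :
  \sum_(j < m) (Bmx k l m c i j)%:P * w j =
  (sub i)%:P * w i.-1 + (rsum i - sub i)%:P * w i.+1.
Proof.
have lim := ltn_ord i.
transitivity (\sum_(j < m) ((if j == i.-1 :> nat then (sub i)%:P * w j else 0) +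
   (if j == i.+1 :> nat then (rsum i - sub i)%:P * w j else 0))).
  apply: eq_bigr => j _; rewrite mxE -/(sub i) -/(rsum i).
  case: (posnP i) => [i0|ip].
    rewrite /sub /Bmx_sub i0 /= !polyC0 !mul0r if_same add0r.
    by case: eqP => //; rewrite polyC0 mul0r.
  have -> : (nat_of_ord i == j.+1) = (nat_of_ord j == i.-1) by lia.
  case: (nat_of_ord j =P i.-1) => [e|_]; last first.
    by rewrite add0r; case: ifP => //; rewrite polyC0 mul0r.
  have -> : (nat_of_ord j == i.+1) = false by lia.
  by rewrite addr0.
rewrite big_split /= (sum_ord_eq _ _ (fun j => (sub i)%:P * w j)).
rewrite (sum_ord_eq _ _ (fun j => (rsum i - sub i)%:P * w j)).
rewrite (leq_ltn_trans (leq_pred _) lim); congr (_ + _).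
case: ltnP => // mi; have im : i.+1 = m by lia.
suff -> : rsum i = sub i by rewrite subrr polyC0 mul0r.
have oi : odd i by move: im; rewrite /m; lia.
rewrite /rsum /sub /Bmx_row_sum /Bmx_sub im eqxx oi.
by rewrite gtn_eqF ?odd_gt0 // /m mul2n odd_double.
Qed.

Lemma Bmx_mull (w : nat -> {poly R}) (j : 'I_m) :
  \sum_(i < m) w i * (Bmx k l m c i j)%:P =
  (if (j.+1 < m)%N then w j.+1 * (sub j.+1)%:P else 0) +
  (if (0 < j)%N then w j.-1 * (rsum j.-1 - sub j.-1)%:P else 0).
Proof.
transitivity (\sum_(i < m) ((if i == j.+1 :> nat then w i * (sub i)%:P else 0) +
   (if i == j.-1 :> nat then
      (if (0 < j)%N then w i * (rsum i - sub i)%:P else 0) else 0))).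
  apply: eq_bigr => i _; rewrite mxE -/(sub i) -/(rsum i).
  case: (nat_of_ord i =P j.+1) => [e|_] /=.
    have -> : (nat_of_ord i == j.-1) = false by lia.
    by rewrite addr0.
  rewrite add0r; case: (posnP j) => [j0|jp].
    by rewrite if_same j0 polyC0 mulr0.
  have -> : (nat_of_ord j == i.+1) = (nat_of_ord i == j.-1) by lia.
  by case: ifP => // _; rewrite polyC0 mulr0.
rewrite big_split /= (sum_ord_eq _ _ (fun i => w i * (sub i)%:P)).
rewrite (sum_ord_eq _ _ (fun i => if (0 < j)%N then w i * (rsum i - sub i)%:P else 0)).
by rewrite (leq_ltn_trans (leq_pred _) (ltn_ord j)).
Qed.

(** Both sides are monic of degree 2n + 4, so divisibility suffices. It comes from a row W for which
    W (X - B) is supported in the last column, multiplied by the adjugate of X - B. *)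
Lemma char_poly_Bmx :
  char_poly (Bmx k l m c) =
  ('X^2 - ((k * l)%:R)%:P) * (endpolyX k l n c \Po 'X^2).
Proof.
(* [F j] counts the nonbacktracking walks of length exactly j; its recurrence [FS] makes the columns
   of W (X - B) vanish away from the right end. *)
pose F j : {poly R} := walk k l 'X j - (if (1 < j)%N then walk k l 'X j.-2 else 0).
pose r j : R := (if odd j then l else k)%:R.
have FS j : F j.+2 = 'X * F j.+1 - (r j - (0 < j)%:R)%:P * F j.
  rewrite /F /r polyCB !polyC_natr; case: j => [|[|j]].
  - by rewrite !walkSS walk1 walk0 /=; ring.
  - by rewrite !walkSS walk1 walk0 /=; ring.
  - by rewrite !walkSS /= negbK; ring.
(* [W (X - B)] vanishes except in the last column, where its entry is [G]; and
   (X - B) rho is X^2 - kl on the even rows and 0 on the odd ones, so pairing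
   the two gives l G = (X^2 - kl) (sum of the even entries of W). *)
pose V2 := (c^-1)%:P * F n.*2.+2.
(* The last two entries solve columns 2n + 1 and 2n + 2, where the subdiagonal entries c and l
   replace 1. *)
pose V j : {poly R} := if (j < n.*2.+2)%N then F j else
  if j == n.*2.+2 then V2 else
  (l%:R^-1)%:P * ('X * V2 - (l%:R - 1)%:P * F n.*2.+1).
have mE : m = n.*2.+4 by rewrite /m mul2n !doubleS.
have cN0 : c != 0 by rewrite gt_eqF.
have lN0 : l%:R != 0 :> R by rewrite pnatr_eq0 -lt0n.
have subE j : (0 < j < n.*2.+2)%N -> sub j = 1.
  move=> hj; rewrite /sub /Bmx_sub mE.
  have -> : (j == 0%N) = false by lia.
  have -> : (j.+1 == n.*2.+4) = false by lia.
  by have -> : (j.+2 == n.*2.+4) = false by lia.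
have sub0 : sub 0 = 0 by [].
have sub2 : sub n.*2.+2 = c.
  by rewrite /sub /Bmx_sub mE /= eqxx; have -> : (n.*2.+3 == n.*2.+4) = false by lia.
have sub3 : sub n.*2.+3 = l%:R.
  by rewrite /sub /Bmx_sub mE /= eqxx /= odd_double.
have rowr j : rsum j = r j by rewrite /rsum /Bmx_row_sum /r; case: odd.
pose W : 'rV[{poly R}]_m := \row_j V j.
have imax : (m.-1 < m)%N by rewrite mE.
pose last := Ordinal imax.
pose G := (W *m char_poly_mx (Bmx k l m c)) 0 last.
have chE (M : 'M[R]_m) i j : char_poly_mx M i j = 'X *+ (i == j) - (M i j)%:P by rewrite !mxE.
have WE j : W 0 j = V j by rewrite mxE.
have WG : W *m char_poly_mx (Bmx k l m c) = G *: delta_mx 0 last.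
  apply/rowP => j; rewrite [RHS]mxE [delta_mx _ _ _ _]mxE eqxx /=.
  case: (eqVneq j last) => [->|]; first by rewrite mulr1.
  rewrite -val_eqE => jl; rewrite mulr0 mxE.
  transitivity ('X * V j - \sum_(i < m) V i * (Bmx k l m c i j)%:P).
    rewrite (bigD1 j) //= [in RHS](bigD1 j) //= opprD addrA -sumrN.
    congr (_ + _); first by rewrite WE chE eqxx mulr1n mulrBr mulrC.
    by apply: eq_bigr => i ij; rewrite WE chE (negPf ij) mulr0n sub0r mulrN.
  have jm : (j < n.*2.+3)%N by have := ltn_ord j; move: jl => /=; rewrite /m; lia.
  have jm1 : (j.+1 < m)%N by move: jm; move: (nat_of_ord j) => jj; rewrite mE; lia.
  rewrite Bmx_mull jm1.
  case: (posnP j) => [j0|jp].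
    by rewrite j0 addr0 subE // /V /= /F /= walk0 walk1; ring.
  have FE i : (0 < i)%N -> F i.+1 = 'X * F i - (r i.-1 - (0 < i.-1)%:R)%:P * F i.-1.
    by case: i => // i _; rewrite FS.
  have s1 : sub j.-1 = (0 < j.-1)%:R.
    by case: (posnP j.-1) => [-> //|jp1]; rewrite subE //; lia.
  have VF i : (i < n.*2.+2)%N -> V i = F i by rewrite /V => ->.
  rewrite rowr s1 [V j.-1]VF; last by lia.
  case: (ltngtP j n.*2.+1) => hj; last 1 first.
  - rewrite hj sub2 [V n.*2.+1]VF //= /V ltnn eqxx /V2 [_ * c%:P]mulrAC -polyCM.
    by rewrite mulVf // polyC1 (FE n.*2.+1) //=; ring.
  - rewrite subE; last by lia.
    rewrite [V j]VF; last by lia.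
    by rewrite [V _]VF // (FE j) // polyC1; ring.
  have je : nat_of_ord j = n.*2.+2 by lia.
  rewrite je sub3 /V ltnn eqxx /= ltnNge leqnSn /= gtn_eqF // [_ * l%:R%:P]mulrAC.
  by rewrite -polyCM mulVf // polyC1 /r /= odd_double; ring.
have wG : l%:R%:P * (c%:P * G) = ('X^2 - (k * l)%:R%:P) * (endpolyX k l n c \Po 'X^2).
  pose rho (j : nat) : {poly R} := if odd j then l%:R%:P else 'X.
  transitivity (c%:P * \sum_(j < m) (W *m char_poly_mx (Bmx k l m c)) 0 j * rho j).
    have GE j : (G *: delta_mx 0 last : 'rV_m) 0 j = G * (j == last)%:R.
      by rewrite mxE [delta_mx _ _ _ _]mxE eqxx.
    rewrite WG (bigD1 last) //= big1 => [|j jl]; last first.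
      by rewrite !GE (negPf jl) mulr0 mul0r.
    have ol : odd last by rewrite -[nat_of_ord last]/m.-1 mE /= odd_double.
    by rewrite !GE eqxx mulr1 addr0 /rho ol; ring.
  have -> : \sum_(j < m) (W *m char_poly_mx (Bmx k l m c)) 0 j * rho j =
      \sum_(i < m) (if odd i then 0 else V i * ('X^2 - (k * l)%:R%:P)).
    under eq_bigr => j _ do rewrite mxE big_distrl /=.
    rewrite exchange_big /=; apply: eq_bigr => i _.
    under eq_bigr => j _ do rewrite WE -mulrA.
    rewrite -big_distrr /=.
    have -> : \sum_(j < m) char_poly_mx (Bmx k l m c) i j * rho j =
       'X * rho i - \sum_(j < m) (Bmx k l m c i j)%:P * rho j.
      rewrite (bigD1 i) //= [in RHS](bigD1 i) //= opprD addrA -sumrN.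
      congr (_ + _); first by rewrite chE eqxx mulr1n mulrBl.
      by apply: eq_bigr => j ij; rewrite chE eq_sym (negPf ij) mulr0n sub0r mulNr.
    rewrite Bmx_mulr rowr /r /rho /= natrM.
    case: (nat_of_ord i) => [|i'] /=.
      by rewrite sub0 polyCB polyCM polyC0; ring.
    by case: (odd i') => /=; rewrite ?polyCB ?polyCM; ring.
  have -> : m = n.+2.*2 by rewrite mE !doubleS.
  rewrite (sum_even (fun i => V i * ('X^2 - (k * l)%:R%:P))) -big_distrl /=.
  rewrite [RHS]mulrC mulrA; congr (_ * _).
  rewrite big_ord_recr /= {2}/V doubleS ltnn eqxx /V2 mulrDr mulrA -polyCM mulfV // mul1r.
  (* The even [F] telescope to ball_n(X^2), and F_(2n+2) is ball_(n+1)(X^2) - ball_n(X^2); so c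
     times the sum of the even entries is P(X^2). *)
  have -> : \sum_(i < n.+1) V i.*2 = walk k l 'X n.*2.
    transitivity (\sum_(i < n.+1) F i.*2).
      by apply: eq_bigr => i _; rewrite /V ifT //; have := ltn_ord i; lia.
    elim: n => [|p IH]; first by rewrite big_ord_recr big_ord0 /F /= add0r subr0.
    by rewrite big_ord_recr /= IH /F doubleS /= addrC subrK.
  rewrite /F /= -doubleS !walk_ball /endpolyX /endpoly.
  rewrite comp_polyD comp_polyM comp_polyB comp_polyC comp_polyC.
  have ballE j : ball k l ('X : {poly R}) j \Po 'X^2 = ball k l 'X^2 j.
    by rewrite -[LHS]/(comp_poly _ _) rmorph_ball /= comp_polyX.
  by rewrite !ballE polyC1; ring.
have m_gt0 : (0 < m)%N by rewrite mE.
pose a := (\adj (char_poly_mx (Bmx k l m c))) last (Ordinal m_gt0).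
set D := _ * (_ \Po _) in wG *.
(* Compare the entries of index 0 in W (X - B) adj(X - B) = chi W, where W has first entry 1. *)
have chiG : (l%:R * c) *: char_poly (Bmx k l m c) = D * a.
  have : (W *m char_poly_mx (Bmx k l m c)) *m \adj (char_poly_mx (Bmx k l m c)) =
         char_poly (Bmx k l m c) *: W.
    by rewrite -mulmxA mul_mx_adj mul_mx_scalar.
  move=> /matrixP /(_ 0 (Ordinal m_gt0)); rewrite WG -scalemxAl -rowE.
  rewrite [LHS]mxE [row _ _ _ _]mxE -/a [RHS]mxE WE /V /= /F /= walk0 subr0 mulr1.
  by move=> <-; rewrite -wG -mul_polyC polyCM; ring.
have [sE mE'] := size_endpolyX k l n c.
have sX : size ('X^2 : {poly R}) = 3%N by rewrite size_polyXn.
have D2 : ('X^2 - (k * l)%:R%:P : {poly R}) \is monic.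
  by rewrite monicXnsubC.
have mC : endpolyX k l n c \Po 'X^2 \is monic.
  by rewrite monicE lead_coef_comp ?sX // (monicP mE') (monicP (monicXn _ _)) expr1n mulr1.
have mD : D \is monic by rewrite monicMl.
have sD : size D = m.+1.
  rewrite size_monicM ?monic_neq0 // size_XnsubC // -[size (_ \Po _)]prednK.
    by rewrite size_comp_poly sE sX mE; lia.
  by rewrite size_poly_gt0 monic_neq0.
apply/eqP; rewrite -eqp_monic ?char_poly_monic // eqp_sym -dvdp_size_eqp.
  by rewrite sD size_char_poly.
rewrite -(@dvdpZr _ (l%:R * c)) ?mulf_neq0 // chiG.
exact: dvdp_mulr.
Qed.

End CharPoly.

(** Since P > 0 from kl on, sqrt(kl) is a simple root of the characteristic polynomial and no root
    is larger, so the second entry of the list falls below it. The alternative theta^2 = kl does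
    occur: for n = 0 and c > k the only real eigenvalues are sqrt(kl) and -sqrt(kl). *)
Lemma second_largest_Bmx {R : realType} (k l n : nat) (c theta : R) :
  (0 < k)%N -> (0 < l)%N -> 0 < c ->
  second_largest_eigenvalue (Bmx k l (2 * n.+2)%N c) theta ->
  theta < Num.sqrt (k * l)%:R /\
  (theta ^+ 2 = (k * l)%:R \/ endpoly k l n c (theta ^+ 2) = 0).
Proof.
move=> k0 l0 c0 [s [[srt cnt] sz <-]].
set chi := char_poly _ in cnt.
have chiE x : chi.[x] = (x ^+ 2 - (k * l)%:R) * endpoly k l n c (x ^+ 2).
  by rewrite /chi char_poly_Bmx // hornerM horner_comp horner_endpolyX !hornerE.
have mem_root x : x \in s -> root chi x.
  rewrite -has_pred1 has_count cnt; apply: contraTT => /mupNroot ->.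
  by [].
have s1 : s`_1 \in s by rewrite mem_nth.
have roots x : x \in s -> x ^+ 2 = (k * l)%:R \/ endpoly k l n c (x ^+ 2) = 0.
  move=> /mem_root /rootP; rewrite chiE => /eqP; rewrite mulf_eq0 subr_eq0.
  by case/orP => /eqP; [left|right].
split; last exact: roots.
rewrite ltNge; apply/negP => ge1.
set a := Num.sqrt _ in ge1.
have a2 : a ^+ 2 = (k * l)%:R by rewrite sqr_sqrtr.
have a0 : 0 < a by rewrite sqrtr_gt0 ltr0n muln_gt0 k0.
have eqa x : x \in s -> a <= x -> x = a.
  move=> xs ax; have x0 := lt_le_trans a0 ax.
  have : (k * l)%:R <= x ^+ 2 by rewrite -a2 lerXn2r // nnegrE ltW.
  case: (roots _ xs) => [e _|e le]; last first.
    by have := endpoly_gt0 _ _ k0 l0 n _ _ c0 le; rewrite e ltxx.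
  by apply: (pexpIrn (n := 2)); rewrite ?nnegrE ?ltW // a2 e.
case: s srt cnt sz mem_root s1 roots eqa ge1 => [|x [|y s]] //= srt cnt _ _ _ _ eqa ge1.
have xy : y <= x by case/andP: srt.
have ya : y = a by apply: eqa => //; rewrite !inE eqxx orbT.
have xa : x = a by apply: eqa; rewrite ?inE ?eqxx // (le_trans ge1).
have := cnt a; rewrite ya xa eqxx /chi char_poly_Bmx //.
have -> : 'X^2 - (k * l)%:R%:P = ('X - a%:P) ^+ 1 * ('X + a%:P).
  by rewrite -a2 expr1 rmorphXn /=; ring.
rewrite -mulrA mupMl.
  by rewrite mup_XsubCX eqxx.
rewrite rootM negb_or !rootE horner_comp horner_endpolyX !hornerE.
rewrite gt_eqF ?addr_gt0 //= a2 gt_eqF //.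
exact: endpoly_gt0.
Qed.

(** * Real symmetric matrices *)

Lemma Re_sum {R : rcfType} {I : finType} (F : I -> R[i]) :
  complex.Re (\sum_i F i) = \sum_i complex.Re (F i).
Proof. by apply: (big_morph (@complex.Re R)) => // -[a b] [c d]. Qed.

Lemma Im_sum {R : rcfType} {I : finType} (F : I -> R[i]) :
  complex.Im (\sum_i F i) = \sum_i complex.Im (F i).
Proof. by apply: (big_morph (@complex.Im R)) => // -[a b] [c d]. Qed.

Lemma char_poly_similar {F : fieldType} n (P A D : 'M[F]_n) :
  P \in unitmx -> P *m A = D *m P -> char_poly A = char_poly D.
Proof.
move=> Pu PA.
have e : map_mx polyC P *m char_poly_mx A = char_poly_mx D *m map_mx polyC P.
  by rewrite mulmxBr mulmxBl -!map_mxM PA scalar_mxC.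
have := congr1 determinant e; rewrite !det_mulmx mulrC => /mulIf; apply.
by rewrite det_map_mx polyC_eq0 -unitfE -unitmxE.
Qed.

(** Over [R[i]] the matrix is Hermitian with real spectrum, so the real and imaginary parts of each
    row of the diagonalizing unitary matrix satisfy the eigenvector equation. The two frame
    identities are the real parts of the unitarity relations. *)
Lemma symmetric_eigenframe {R : rcfType} n (A : 'M[R]_n) :
  (forall x y, A x y = A y x) ->
  exists (d : 'I_n -> R) (u : 'I_n -> bool -> 'I_n -> R),
  [/\ char_poly A = \prod_i ('X - (d i)%:P),
      forall x y, \sum_i \sum_e u i e x * u i e y = (x == y)%:R,
      forall i, \sum_e \sum_x u i e x ^+ 2 = 1
    & forall i e y, \sum_x u i e x * A x y = d i * u i e y].
Proof.
move=> Asym; pose f := real_complex R; pose Ac := map_mx f A.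
have Ah : Ac \is hermsymmx.
  apply: realsym_hermsym.
    by apply/is_hermitianmxP/matrixP => x y; rewrite expr0 scale1r !mxE Asym.
  by apply/mxOverP => x y; rewrite mxE complex_real.
have Dr := hermitian_spectral_diag_real Ah.
have /orthomx_spectralP := hermitian_normalmx Ah.
set P := spectralmx Ac in Dr *; set D := spectral_diag Ac in Dr * => AE.
have Punitary : P \is unitarymx := spectral_unitarymx _.
have Pu := unitarymx_unit Punitary.
have PA : P *m Ac = diag_mx D *m P by rewrite [in LHS]AE !mulmxA mulmxV // mul1mx.
pose d i := complex.Re (D 0 i).
have dE i : D 0 i = f (d i).
  by rewrite /f /d RRe_real //; apply: (mxOverP Dr).
have PPt : (P *m P^t* = 1%:M)%sesqui by apply/unitarymxP.
have PtP : (P^t* *m P = 1%:M)%sesqui by rewrite -invmx_unitary // mulVmx.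
pose u i (e : bool) x := if e then complex.Re (P i x) else complex.Im (P i x).
have ReJM (z w : R[i]) :
    complex.Re (z^* * w) = complex.Re z * complex.Re w + complex.Im z * complex.Im w.
  by case: z w => [a b] [a' b'] /=; ring.
have ReMf (z : R[i]) r : complex.Re (z * f r) = complex.Re z * r.
  by case: z => [a b] /=; ring.
have ImMf (z : R[i]) r : complex.Im (z * f r) = complex.Im z * r.
  by case: z => [a b] /=; ring.
exists d, u; split.
- apply: (map_poly_inj f); rewrite map_char_poly (char_poly_similar _ _ _ _ Pu PA).
  rewrite char_poly_trig ?diag_mx_is_trig // rmorph_prod; apply: eq_bigr => i _ /=.
  by rewrite rmorphB /= map_polyX map_polyC /= mxE eqxx mulr1n dE.
- move=> x y; have /matrixP/(_ x y) := PtP; rewrite !mxE => /(congr1 (@complex.Re R)).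
  rewrite Re_sum => e; transitivity (complex.Re ((x == y)%:R : R[i])); last by case: eqP.
  by rewrite -e; apply: eq_bigr => i _; rewrite big_bool /= !mxE ReJM.
- move=> i; have /matrixP/(_ i i) := PPt; rewrite !mxE eqxx => /(congr1 (@complex.Re R)).
  rewrite Re_sum /= => <-; rewrite exchange_big; apply: eq_bigr => x _.
  by rewrite big_bool /= !mxE mulrC ReJM.
- move=> i e y; have /matrixP/(_ i y) := PA.
  rewrite mul_diag_mx !mxE dE mulrC => PAi.
  case: e; [have := congr1 (@complex.Re R) PAi | have := congr1 (@complex.Im R) PAi].
    rewrite Re_sum ReMf mulrC => <-; apply: eq_bigr => x _.
    by rewrite mxE ReMf.
  rewrite Im_sum ImMf mulrC => <-; apply: eq_bigr => x _.
  by rewrite mxE ImMf.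
Qed.

(* The index [e] selects the real or the imaginary part of a complex unitary
   eigenbasis; the two real families together form a tight frame, which serves
   as well as an orthonormal eigenbasis. *)
Definition eigenframe {R : realFieldType} {V I : finType} (a : V -> V -> R)
    (d : I -> R) (u : I -> bool -> V -> R) : Prop :=
  [/\ forall x y, \sum_i \sum_e u i e x * u i e y = (x == y)%:R,
      forall i, \sum_e \sum_x u i e x ^+ 2 = 1
    & forall i e y, \sum_x u i e x * a x y = d i * u i e y].

(* The entry (x, y) of the matrix p(A). *)
Definition fcalc {R : realFieldType} {V I : finType} (d : I -> R)
    (u : I -> bool -> V -> R) (x y : V) (p : {poly R}) : R :=
  \sum_i \sum_e p.[d i] * (u i e x * u i e y).

Lemma adjacency_eigenframe {R : rcfType} {V : finType} (adj : rel V) :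
  symmetric adj ->
  exists (d : 'I_#|V| -> R) u,
    eigenframe (fun x y => (adj x y)%:R) d u /\
    char_poly (\matrix_(i, j) (adj (enum_val i) (enum_val j))%:R : 'M[R]_#|V|)
      = \prod_i ('X - (d i)%:P).
Proof.
move=> adjC.
set A := (\matrix_(i, j) _).
have Asym i j : A i j = A j i by rewrite !mxE adjC.
have [d [u [chiE pars unit eig]]] := symmetric_eigenframe _ _ Asym.
have sumE (F : V -> R) : \sum_(x : V) F x = \sum_(i < #|V|) F (enum_val i).
  by rewrite -(big_enum_val (A := V)).
exists d, (fun i e x => u i e (enum_rank x)); split=> //; split.
- by move=> x y; rewrite pars (inj_eq enum_rank_inj).
- move=> i; rewrite -(unit i); apply: eq_bigr => e _; rewrite sumE.
  by apply: eq_bigr => x _; rewrite enum_valK.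
- move=> i e y; rewrite -(eig i e) sumE.
  by apply: eq_bigr => x _; rewrite mxE enum_valK enum_rankK.
Qed.

(** * Polynomials in a matrix, evaluated through an eigenframe *)

Section FunctionalCalculus.
Context {R : realFieldType} {V I : finType} (a : V -> V -> R).
Context (d : I -> R) (u : I -> bool -> V -> R).
Hypothesis fr : eigenframe a d u.
Local Notation L := (fcalc d u).

Lemma fcalc1 x y : L x y 1 = (x == y)%:R.
Proof.
case: fr => <- _ _; apply: eq_bigr => i _; apply: eq_bigr => e _.
by rewrite hornerC mul1r.
Qed.

Lemma fcalcC x y p : L x y p = L y x p.
Proof. by apply: eq_bigr => i _; apply: eq_bigr => e _; rewrite [u _ _ x * _]mulrC. Qed.

Lemma fcalcD x y p q : L x y (p + q) = L x y p + L x y q.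
Proof.
rewrite -big_split; apply: eq_bigr => i _; rewrite -big_split.
by apply: eq_bigr => e _; rewrite hornerD mulrDl.
Qed.

Lemma fcalcZ x y c p : L x y (c%:P * p) = c * L x y p.
Proof.
rewrite /fcalc big_distrr /=; apply: eq_bigr => i _; rewrite big_distrr /=.
by apply: eq_bigr => e _; rewrite hornerCM mulrA.
Qed.

Lemma fcalc0 x y : L x y 0 = 0.
Proof. by rewrite -(mul0r (0 : {poly R})) -polyC0 fcalcZ mul0r. Qed.

Lemma fcalcB x y p q : L x y (p - q) = L x y p - L x y q.
Proof. by rewrite -[- q]mulN1r -polyC1 -polyCN fcalcD fcalcZ mulN1r. Qed.

Lemma fcalc_sum x y n (F : 'I_n -> {poly R}) :
  L x y (\sum_i F i) = \sum_i L x y (F i).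
Proof. exact: (big_morph _ (fcalcD x y) (fcalc0 x y)). Qed.

Lemma fcalcX x y p : L x y (p * 'X) = \sum_z L x z p * a z y.
Proof.
case: fr => _ _ eig; rewrite /fcalc.
under [RHS]eq_bigr => z _ do rewrite big_distrl /=.
rewrite [RHS]exchange_big; apply: eq_bigr => i _.
under [RHS]eq_bigr => z _ do rewrite big_distrl /=.
rewrite [RHS]exchange_big; apply: eq_bigr => e _ /=.
under [RHS]eq_bigr => z _ do rewrite -!mulrA.
rewrite -!big_distrr /= hornerMX eig; ring.
Qed.

(** A frame is not an orthogonal basis, so the product is not computed term by term in the frame;
    induction on [q] reduces it to [fcalcX]. *)
Lemma fcalcM x y p q : L x y (p * q) = \sum_z L x z p * L z y q.
Proof.
elim/poly_ind: q y => [|q c IH] y.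
  by rewrite mulr0 fcalc0 big1 // => z _; rewrite fcalc0 mulr0.
rewrite mulrDr fcalcD mulrA [p * c%:P]mulrC fcalcZ fcalcX.
under [RHS]eq_bigr => z _ do
  rewrite fcalcD mulrDr fcalcX -[c%:P]mulr1 fcalcZ fcalc1 mulrCA.
rewrite big_split /= -[in RHS]big_distrr /=; congr (_ + c * _).
  under eq_bigr => w _ do rewrite IH big_distrl /=.
  rewrite exchange_big; apply: eq_bigr => z _ /=.
  by rewrite big_distrr /=; apply: eq_bigr => w _; rewrite mulrA.
rewrite (bigD1 y) //= eqxx mulr1 big1 ?addr0 // => z zy.
by rewrite (negPf zy) mulr0.
Qed.

Lemma fcalc_eigen (t : R) (h : V -> R) x p :
  (forall y, \sum_z a y z * h z = t * h y) ->
  \sum_y L x y p * h y = p.[t] * h x.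
Proof.
move=> hh; elim/poly_ind: p => [|p c IH].
  by rewrite horner0 mul0r big1 // => y _; rewrite fcalc0 mul0r.
under eq_bigr => y _ do rewrite fcalcD mulrDl -[c%:P]mulr1 fcalcZ fcalc1 fcalcX.
rewrite big_split /= hornerMXaddC mulrDl; congr (_ + _).
  rewrite mulrAC -IH big_distrl /=.
  under eq_bigr => y _ do rewrite big_distrl /=.
  rewrite exchange_big; apply: eq_bigr => z _ /=.
  rewrite -mulrA [h z * t]mulrC -hh big_distrr /=.
  by apply: eq_bigr => y _; rewrite mulrA.
rewrite (bigD1 x) //= eqxx mulr1 big1 ?addr0 // => y yx.
by rewrite eq_sym (negPf yx) mulr0 mul0r.
Qed.

(** If [t] were not a value of [d], then [h] would be orthogonal to every frame vector, and its
    frame expansion would make it zero. *)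
Lemma eigenframe_eigenvalue (t : R) (h : V -> R) y0 :
  h y0 != 0 -> (forall y, \sum_z a y z * h z = t * h y) ->
  exists i, d i = t.
Proof.
move=> h0 hh; case: (pickP (fun i => d i == t)) => [i /eqP|none]; first by exists i.
case: fr => pars _ eig.
have orth i e : \sum_x u i e x * h x = 0.
  have : (d i - t) * \sum_x u i e x * h x = 0.
    rewrite mulrBl !big_distrr /=; apply/eqP; rewrite subr_eq0; apply/eqP.
    transitivity (\sum_y \sum_x u i e x * a x y * h y).
      by apply: eq_bigr => y _; rewrite -big_distrl /= eig mulrA.
    rewrite exchange_big; apply: eq_bigr => x _ /=.
    rewrite mulrCA -hh big_distrr /=; by apply: eq_bigr => y _; rewrite mulrA.
  by move/eqP; rewrite mulf_eq0 subr_eq0 none => /eqP.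
case/eqP: h0; transitivity (\sum_y (y0 == y)%:R * h y).
  rewrite (bigD1 y0) //= eqxx mul1r big1 ?addr0 // => y yx.
  by rewrite eq_sym (negPf yx) mul0r.
under eq_bigr => y _ do rewrite -pars big_distrl /=.
rewrite exchange_big big1 // => i _.
under eq_bigr => y _ do rewrite big_distrl /=.
rewrite exchange_big big1 // => e _.
under eq_bigr => y _ do rewrite -mulrA.
by rewrite -big_distrr /= orth mulr0.
Qed.

End FunctionalCalculus.

(** * Counting nonbacktracking walks *)

Section NonBacktracking.
Context {V : finType} (adj : rel V).
Hypothesis adjC : symmetric adj.

(* Nonbacktracking walks from [x] of length [j.+1] whose last arc is [(u, v)]. *)
Fixpoint nbarc (j : nat) (x u v : V) : nat :=
  if j is j'.+1 then adj u v * \sum_(w | w != v) nbarc j' x w u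
  else (x == u) && adj u v.

Definition nbwalk (j : nat) (x v : V) : nat :=
  if j is j'.+1 then \sum_u nbarc j' x u v else x == v.

(** The lengths summed over are j, j - 2, and so on: these are the counts encoded by [walk]. *)
Fixpoint nbcum (j : nat) (x v : V) : nat :=
  match j with
  | 0 => nbwalk 0 x v
  | j'.+1 =>
      match j' with
      | 0 => nbwalk 1 x v
      | j''.+1 => nbcum j'' x v + nbwalk j x v
      end
  end.

Lemma nbarc_adj j x u v : ~~ adj u v -> nbarc j x u v = 0%N.
Proof. by case: j => [|j] /= /negPf ->; rewrite ?andbF. Qed.

(** A walk continues to any neighbour of its end, except the one it has just come from when its
    length is positive. *)
Lemma sum_nbarc j x u :
  (\sum_v nbarc j x u v = nbwalk j x u * (valency adj u - (0 < j)))%N.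
Proof.
rewrite /valency -sum1dep_card; case: j => [|j] /=.
  rewrite subn0 big_distrr big_mkcond [RHS]big_mkcond /=; apply: eq_bigr => v _.
  by rewrite muln1; case: (x == u); case: (adj u v).
rewrite big_distrl /=.
under eq_bigr => v _ do rewrite big_distrr /= big_mkcond /=.
rewrite exchange_big; apply: eq_bigr => w _ /=.
have [wu|/(nbarc_adj j x) w0] := boolP (adj w u); last first.
  by rewrite w0 mul0n big1 // => v _; rewrite muln0 if_same.
rewrite [in RHS](bigD1 w) /=; last by rewrite adjC.
rewrite addKn big_distrr [RHS]big_mkcond /=; apply: eq_bigr => v _.
by rewrite (eq_sym v w); case: (adj u v); case: (w == v); rewrite ?muln1 ?mul1n ?mul0n.
Qed.

(** An arc appended to a walk of length j + 1 either extends it or reverses its last arc. In the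
    second case the walk is one of length j ending at [v] followed by a continuation, as counted by
    [sum_nbarc]. *)
Lemma nbwalkSS j x v :
  (nbwalk j.+2 x v + nbwalk j x v * (valency adj v - (0 < j)) =
   \sum_u adj u v * nbwalk j.+1 x u)%N.
Proof.
rewrite -sum_nbarc /= -big_split; apply: eq_bigr => u _ /=.
rewrite [in RHS](bigD1 v) //= mulnDr addnC; congr (_ + _)%N.
have [uv|uv] := boolP (adj u v); first by rewrite mul1n.
by rewrite nbarc_adj // adjC.
Qed.

End NonBacktracking.

(** * Semiregular bipartite graphs *)

Lemma mup_prod_XsubC {F : fieldType} (x : F) (r : seq F) :
  mup x (\prod_(y <- r) ('X - y%:P)) = count_mem x r.
Proof.
elim: r => [|y r IH]; first by rewrite big_nil mupNroot // root1.
rewrite big_cons mupM ?polyXsubC_eq0 //; last first.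
  by rewrite monic_neq0 // monic_prod_XsubC.
by rewrite IH /= -['X - _]expr1 mup_XsubCX; case: eqP.
Qed.

(** The list of eigenvalues is a rearrangement of the values of [d], and in a nonincreasing list
    only the first entry can exceed the second. *)
Lemma second_largest_unique_above {R : realType} n (A : 'M[R]_n) (d : 'I_n -> R) lam :
  char_poly A = \prod_i ('X - (d i)%:P) -> second_largest_eigenvalue A lam ->
  forall i j, lam < d i -> lam < d j -> i = j.
Proof.
move=> chiE [s [[srt cnt] sz s1]].
have sd : perm_eq s (codom d).
  apply/allP => x _; rewrite /= cnt chiE -mup_prod_XsubC.
  by rewrite /codom /image_mem big_map big_enum.
have : (count (fun y => (lam < y)%R) s <= 1)%N.
  case: s srt sz s1 {cnt sd} => [|y [|z s]] //= /andP[_ srt] _ zl.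
  have /eqP -> : count (fun y => (lam < y)%R) s == 0%N.
    rewrite -leqn0 leqNgt -has_count; apply/hasPn => w ws.
    have := order_path_min (rev_trans le_trans) srt => /allP/(_ _ ws).
    by rewrite zl -leNgt.
  by rewrite zl ltxx addn0; case: (lam < y).
rewrite (permP sd) /codom /image_mem count_map -sum1_count big_enum_cond => h i j hi hj.
have /card_le1_eqP : (#|[pred i | (lam < d i)%R]| <= 1)%N.
  by rewrite -sum1_card; apply: leq_trans h; apply: eq_leq; apply: eq_bigl.
by apply; rewrite inE.
Qed.

Section SemiregularGraph.
Context {R : realType} {V : finType} (adj : rel V) (B : {set V}) (k l : nat).
Hypotheses (k_gt0 : (0 < k)%N) (l_gt0 : (0 < l)%N).
Hypothesis semireg : semiregular_bipartite k l adj B.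

Let adjC : symmetric adj. Proof. by case: semireg. Qed.

Let adj_side x y : adj x y -> (y \in B) = ~~ (x \in B).
Proof. by case: semireg => _ _ bip _ _ /bip; case: (x \in B); case: (y \in B). Qed.

Let valE x : valency adj x = if x \in B then k else l.
Proof. by case: semireg => _ _ _ vB vC; case: ifPn => [/vB|/vC]. Qed.

Lemma nbarc_support j x u v :
  nbarc adj j x u v != 0%N -> (u \in B) = (x \in B) (+) odd j.
Proof.
elim: j u v => [|j IH] u v /=; first by case: (eqVneq x u) => [->|//]; rewrite addbF.
rewrite muln_eq0 negb_or => /andP[_]; rewrite sum_nat_eq0 => /forallPn[w].
rewrite negb_imply => /andP[_ nz]; have := IH _ _ nz.
have /adj_side -> : adj w u by apply: contraR nz => /nbarc_adj ->.
by move=> ->; rewrite addbN.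
Qed.

Lemma nbwalk_support j x v :
  nbwalk adj j x v != 0%N -> (v \in B) = (x \in B) (+) odd j.
Proof.
case: j => [|j] /=; first by case: (eqVneq x v) => [->|//]; rewrite addbF.
rewrite sum_nat_eq0 => /forallPn[u]; rewrite negb_imply => /andP[_ nz].
have /adj_side -> : adj u v by apply: contraR nz => /nbarc_adj ->.
by rewrite (nbarc_support _ _ _ _ nz) addbN.
Qed.

Lemma nbcum_support j x v :
  nbcum adj j x v != 0%N -> (v \in B) = (x \in B) (+) odd j.
Proof.
elim/ltn_ind: j => -[|[|j]] IH; try exact: nbwalk_support.
rewrite -[nbcum _ _ _ _]/(nbcum adj j x v + nbwalk adj j.+2 x v)%N addn_eq0.
rewrite negb_and => /orP[/IH-> //|/nbwalk_support -> //]; by rewrite /= negbK.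
Qed.

Lemma nbwalk_rec j x v : x \in B ->
  (nbwalk adj j.+2 x v
   + nbwalk adj j x v * ((if odd j then l else k) - (0 < j)) =
   \sum_u adj u v * nbwalk adj j.+1 x u)%N.
Proof.
move=> xB; rewrite -nbwalkSS //; congr (_ + _)%N.
have [->//|/nbwalk_support] := eqVneq (nbwalk adj j x v) 0%N.
by rewrite xB valE => ->; case: (odd j).
Qed.

(** Cumulating absorbs the exception of [nbwalk_rec] at length 0, where the factor is k and not k -
    1, and yields exactly the recurrence of [walk]. *)
Lemma nbcum_rec j x v : x \in B ->
  (nbcum adj j.+2 x v + nbcum adj j x v * ((if odd j then l else k) - 1) =
   \sum_u adj u v * nbcum adj j.+1 x u)%N.
Proof.
move=> xB.
have cumSS i w : nbcum adj i.+2 x w = (nbcum adj i x w + nbwalk adj i.+2 x w)%N by [].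
elim/ltn_ind: j => -[|[|j]] IH.
- transitivity (\sum_u adj u v * nbwalk adj 1 x u)%N; last by [].
  rewrite -(nbwalk_rec 0 x v xB) cumSS subn0 -[nbcum adj 0 x v]/(nbwalk adj 0 x v) /odd.
  by rewrite addnAC -mulnS subn1 prednK // addnC.
- under eq_bigr => u _ do rewrite cumSS mulnDr.
  rewrite big_split -(nbwalk_rec 1 x v xB) cumSS /= -addnA; congr (_ + _)%N.
  by apply: eq_bigr => u _; rewrite mulnC; case: (x == u); case: (adj u v).
- under eq_bigr => u _ do rewrite cumSS mulnDr.
  rewrite big_split -(nbwalk_rec j.+2 x v xB) -IH // !cumSS /= negbK.
  by rewrite mulnDl; lia.
Qed.

Let a x y : R := (adj x y)%:R.
Context (I : finType) (d : I -> R) (u : I -> bool -> V -> R).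
Hypothesis fr : eigenframe a d u.
Local Notation L := (fcalc d u).

Lemma fcalc_walk j x y : x \in B ->
  L x y (walk k l 'X j) = (nbcum adj j x y)%:R.
Proof.
move=> xB; elim/ltn_ind: j y => -[|[|j]] IH y.
- by rewrite walk0 (fcalc1 _ _ _ fr).
- rewrite walk1 -['X]mul1r (fcalcX _ _ _ fr) (bigD1 x) //= (fcalc1 _ _ _ fr) eqxx mul1r.
  rewrite big1 => [|z zx]; last by rewrite (fcalc1 _ _ _ fr) eq_sym (negPf zx) mul0r.
  rewrite addr0 /= (bigD1 x) //= eqxx big1 ?addn0 // => z zx.
  by rewrite eq_sym (negPf zx).
have -> : walk k l 'X j.+2 = walk k l 'X j.+1 * 'X
    - ((if odd j then l else k) - 1)%:R%:P * walk k l ('X : {poly R}) j.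
  rewrite walkSS natrB; last by case: odd.
  by rewrite polyCB polyC_natr polyC1; ring.
rewrite fcalcB fcalcZ (fcalcX _ _ _ fr) IH //; apply/eqP; rewrite subr_eq mulrC.
rewrite -natrM -natrD nbcum_rec // natr_sum; apply/eqP; apply: eq_bigr => z _.
by rewrite IH // mulrC natrM.
Qed.

Lemma fcalc_ball j x y : x \in B ->
  L x y (ball k l 'X j \Po 'X^2) = (nbcum adj j.*2 x y)%:R.
Proof.
move=> xB; rewrite -fcalc_walk // walk_ball; congr (L _ _ _).
by rewrite -[LHS]/(comp_poly _ _) rmorph_ball /= comp_polyX.
Qed.

Lemma fcalc_even0 p x y : (x \in B) != (y \in B) -> L x y (p \Po 'X^2) = 0.
Proof.
elim/poly_ind: p y => [|p c IH] y xy; first by rewrite comp_poly0 fcalc0.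
rewrite comp_polyD comp_polyM comp_polyX comp_polyC fcalcD -[c%:P]mulr1 fcalcZ.
rewrite (fcalc1 _ _ _ fr) expr2 mulrA (fcalcX _ _ _ fr) big1 => [|z _].
  have /negPf -> : x != y by apply: contraNneq xy => ->.
  by rewrite mulr0 addr0.
have [/adj_side zy|] := boolP (adj z y); last by rewrite /a => /negPf->; rewrite mulr0.
rewrite (fcalcX _ _ _ fr) big1 ?mul0r // => w _.
have [/adj_side wz|] := boolP (adj w z); last by rewrite /a => /negPf->; rewrite mulr0.
by rewrite IH ?mul0r //; move: xy; rewrite zy wz negbK.
Qed.

(** * The spectrum of the graph and the trace estimate *)

Let s : R := Num.sqrt (k * l)%:R.

Let s_gt0 : 0 < s. Proof. by rewrite sqrtr_gt0 ltr0n muln_gt0 k_gt0. Qed.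

(** The Perron vector, with eigenvalue [s]: over the neighbours of a vertex of [B] it sums to k
    sqrt(l) = sqrt(kl) sqrt(k), and symmetrically for the other part. *)
Let g x : R := if x \in B then Num.sqrt k%:R else Num.sqrt l%:R.

Let g_eigen y : \sum_z a y z * g z = s * g y.
Proof.
transitivity (\sum_(z | adj y z) g z).
  rewrite [RHS]big_mkcond /=; apply: eq_bigr => z _.
  by rewrite /a; case: (adj y z); rewrite ?mul1r ?mul0r.
transitivity (\sum_(z in [set z | adj y z])
                 (if y \in B then Num.sqrt l%:R else Num.sqrt k%:R : R)).
  apply: eq_big => z; rewrite ?inE // => /adj_side zE.
  by rewrite /g zE; case: (y \in B).
rewrite sumr_const -/(valency adj y) valE /s /g natrM sqrtrM //.
have k2 : Num.sqrt k%:R ^+ 2 = k%:R :> R by rewrite sqr_sqrtr.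
have l2 : Num.sqrt l%:R ^+ 2 = l%:R :> R by rewrite sqr_sqrtr.
move: k2 l2; set p := Num.sqrt _; set q := Num.sqrt _ => k2 l2.
by case: (y \in B); rewrite -mulr_natr -?k2 -?l2; ring.
Qed.

Let aC x y : a x y = a y x. Proof. by rewrite /a adjC. Qed.

(** Changing the sign of an eigenvector outside [B] negates its eigenvalue, all edges being between
    the parts. *)
Let opp_eigen i : exists j, d j = - d i.
Proof.
have [e [x uN0]] : exists e x, u i e x != 0.
  case: fr => _ /(_ i) unit _.
  case: (pickP (fun p : bool * V => u i p.1 p.2 != 0)) => [[e x] ?|z].
    by exists e, x.
  move: unit; rewrite big1 => [/esym/eqP|e _]; first by rewrite oner_eq0.
  by rewrite big1 // => x _; have /negbFE/eqP -> := z (e, x); rewrite expr0n.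
pose h y := if y \in B then u i e y else - u i e y.
apply: (eigenframe_eigenvalue a _ _ fr (- d i) h x).
  by rewrite /h; case: ifP; rewrite ?oppr_eq0.
move=> y; case: fr => _ _ eig.
transitivity ((if y \in B then -1 else 1) * \sum_z u i e z * a z y).
  rewrite big_distrr; apply: eq_bigr => z _ /=; rewrite aC /a.
  have [/adj_side zE|_] := boolP (adj z y); last by rewrite !mul0r !mulr0.
  by rewrite /h zE; case: (z \in B) => /=; ring.
by rewrite eig /h; case: (y \in B); ring.
Qed.

Let weight i : R := \sum_e \sum_(x in B) u i e x ^+ 2.

Let weight_ge0 i : 0 <= weight i.
Proof. by apply: sumr_ge0 => e _; apply: sumr_ge0 => x _; apply: sqr_ge0. Qed.

(** The sum of u_x a_xy u_y over x outside [B] and y in [B] is d times the mass of u on [B], and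
    also d times its mass outside. *)
Let weight_half i : d i != 0 -> weight i = 2^-1.
Proof.
move=> dN0; case: fr => _ /(_ i) unit eig.
have half e : \sum_(x in B) u i e x ^+ 2 = \sum_(x | x \notin B) u i e x ^+ 2.
  apply: (mulfI dN0); rewrite !big_distrr /=.
  transitivity (\sum_(y in B) \sum_(x | x \notin B) u i e x * a x y * u i e y).
    apply: eq_bigr => y yB; rewrite expr2 mulrA -eig big_distrl /=.
    rewrite [RHS]big_mkcond; apply: eq_bigr => x _ /=; case: ifPn => // xB.
    by rewrite /a; case: (boolP (adj x y)) => [/adj_side|]; rewrite ?yB ?(negPn xB) ?mulr0 ?mul0r.
  rewrite exchange_big /=; apply: eq_bigr => x xB; rewrite expr2 mulrA -eig big_distrl /=.
  rewrite [LHS]big_mkcond; apply: eq_bigr => y _ /=; rewrite aC; case: ifPn => yB; first by ring.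
  rewrite /a; case: (boolP (adj y x)) => [/adj_side|]; rewrite ?(negPf yB) ?(negPf xB) ?mulr0 ?mul0r //.
have : weight i + weight i = 1.
  rewrite -unit -big_split; apply: eq_bigr => e _ /=.
  by rewrite {2}half [RHS](bigID (mem B)).
by lra.
Qed.

(** The eigenvalue [s] occurs once and contributes the right side; those in [-theta, theta]
    contribute at most 0; one below -theta must be -s, by [opp_eigen] and uniqueness. For theta < 0
    the condition on [p] is vacuous. *)
Lemma trace_bound (p : {poly R}) theta (y0 : V) :
  (forall i j, theta < d i -> theta < d j -> i = j) -> theta < s ->
  (forall x, `|x| <= theta -> p.[x ^+ 2] <= 0) ->
  \sum_(x in B) L x x (p \Po 'X^2) <= p.[(k * l)%:R].
Proof.
move=> uniq ths ple0; set f := p \Po 'X^2.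
have fE x : f.[x] = p.[x ^+ 2] by rewrite /f horner_comp hornerXn.
have s2 : s ^+ 2 = (k * l)%:R by rewrite sqr_sqrtr.
have [i0 di0] : exists i, d i = s.
  apply: (eigenframe_eigenvalue a _ _ fr s g y0) => //.
  by rewrite /g; case: ifP; rewrite gt_eqF // sqrtr_gt0 ltr0n.
rewrite -(ler_pM2l s_gt0).
(* Odd powers of A vanish on the diagonal, so f may be multiplied by s + X, which
   kills the eigenvalue - s whatever its multiplicity. *)
have -> : s * \sum_(x in B) L x x f = \sum_i f.[d i] * (d i + s) * weight i.
  transitivity (\sum_(x in B) L x x (f * ('X + s%:P))).
    rewrite big_distrr; apply: eq_bigr => x xB /=.
    rewrite mulrDr fcalcD [f * _%:P]mulrC fcalcZ (fcalcX _ _ _ fr) big1 ?add0r // => z _.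
    have [/adj_side zE|] := boolP (adj z x); last by rewrite /a => /negPf->; rewrite mulr0.
    by rewrite fcalc_even0 ?mul0r // zE; case: (z \in B).
  rewrite exchange_big; apply: eq_bigr => i _; rewrite exchange_big big_distrr.
  apply: eq_bigr => e _; rewrite big_distrr; apply: eq_bigr => x _ /=.
  by rewrite hornerM hornerD hornerX hornerC expr2.
rewrite (bigD1 i0) //= di0 weight_half; last by rewrite di0 gt_eqF.
rewrite fE s2; have -> : p.[(k * l)%:R] * (s + s) / 2 = s * p.[(k * l)%:R] by field.
rewrite gerDl; apply: sumr_le0 => i ii0; apply: mulr_le0_ge0 => //.
have di : d i <= theta.
  rewrite leNgt; apply: contraNN ii0 => hi; apply/eqP/uniq => //; by rewrite di0.
rewrite fE; have [di'|di'] := leP (- theta) (d i).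
  apply: mulr_le0_ge0; first by apply: ple0; rewrite ler_norml di' di.
  by move: di' di ths; lra.
have [j dj] := opp_eigen i.
have ji0 : j = i0 by apply: uniq; rewrite ?di0 // dj; move: di'; lra.
have -> : d i = - s by rewrite -di0 -ji0 dj opprK.
by rewrite addNr mulr0.
Qed.

(** * From the trace estimate to the size of [B] *)

Let nbcum_mono i j x y : (i <= j)%N -> (nbcum adj i.*2 x y <= nbcum adj j.*2 x y)%N.
Proof.
move=> /subnKC <-; elim: (j - i)%N => [|m IH]; first by rewrite addn0.
by apply: leq_trans IH _; rewrite addnS doubleS; exact: leq_addr.
Qed.

(** Pair the row with the Perron vector: even walks from [x] end in [B], where [g] is constant. *)
Let sum_nbcum j x : x \in B ->
  \sum_y (nbcum adj j.*2 x y)%:R = ball k l (k * l)%:R j :> R.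
Proof.
move=> xB; have gx : g x != 0 by rewrite /g xB gt_eqF // sqrtr_gt0 ltr0n.
apply: (mulIf gx).
have s2 : s ^+ 2 = (k * l)%:R by rewrite sqr_sqrtr.
transitivity ((ball k l 'X j \Po 'X^2).[s] * g x); last first.
  by rewrite horner_comp hornerXn s2 horner_ball.
rewrite -(fcalc_eigen a _ _ fr s g) // big_distrl; apply: eq_bigr => y _ /=.
rewrite fcalc_ball //; have [->|/nbcum_support] := eqVneq (nbcum adj j.*2 x y) 0%N.
  by rewrite !mul0r.
by rewrite xB odd_double /g => ->; rewrite xB.
Qed.

(** [n], [c], [mu] and [theta] are kept free of [Bmx], so that the degenerate cases can supply other
    values. *)
Lemma part_bound n (c mu theta : R) :
  (forall i j, theta < d i -> theta < d j -> i = j) -> theta < s ->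
  0 < c -> endpoly k l n c mu = 0 -> theta ^+ 2 <= mu -> mu < (k * l)%:R ->
  (forall j, (j <= n)%N -> 0 < ball k l mu j) ->
  #|B|%:R <= endpoly k l n c (k * l)%:R / c.
Proof.
move=> uniq ths c0 mu0 thmu mukl bpos.
have [->|[x0 x0B]] := set_0Vmem B.
  by rewrite cards0 divr_ge0 ?ltW // endpoly_gt0.
pose q : R := (k%:R - 1) * (l%:R - 1).
have q0 : 0 <= q by rewrite mulr_ge0 // subr_ge0 ler1n.
pose kap j := q ^+ (n - j) * ball k l mu j.
have kap0 (j : 'I_n.+1) : 0 <= kap j.
  by apply: mulr_ge0; [exact: exprn_ge0 | apply/ltW/bpos; rewrite -ltnS].
pose K : {poly R} := \sum_(j < n.+1) (kap j)%:P * ball k l 'X j.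
have KE x : K.[x] = kernel_poly k l n mu x.
  rewrite /K horner_sum; apply: eq_bigr => j _.
  by rewrite hornerCM horner_ball.
pose P := endpolyX k l n c.
have bn0 : 0 < ball k l mu n by apply: bpos.
have Kkl : 0 < K.[(k * l)%:R].
  have : endpoly k l n c (k * l)%:R * ball k l mu n
       = ((k * l)%:R - mu) * K.[(k * l)%:R] by rewrite KE endpoly_kernel.
  have : 0 < endpoly k l n c (k * l)%:R * ball k l mu n.
    by rewrite mulr_gt0 // endpoly_gt0.
  by move=> h1 h2; rewrite h2 pmulr_rgt0 ?subr_gt0 in h1.
have up : \sum_(x in B) L x x ((P * K) \Po 'X^2) <= P.[(k * l)%:R] * K.[(k * l)%:R].
  rewrite -hornerM; apply: (trace_bound _ theta x0) => // x xth.
  have x2 : x ^+ 2 <= mu.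
    apply: le_trans thmu; rewrite -real_normK ?num_real // lerXn2r ?nnegrE //.
    exact: le_trans xth.
  (* After multiplication by ball_n(mu) > 0, the product P K becomes (x^2 - mu) K(x^2)^2. *)
  rewrite -(pmulr_lle0 _ bn0) hornerM mulrAC horner_endpolyX endpoly_kernel // -KE.
  by rewrite -mulrA -expr2 mulr_le0_ge0 ?sqr_ge0 // subr_le0.
have low : c * #|B|%:R * K.[(k * l)%:R] <= \sum_(x in B) L x x ((P * K) \Po 'X^2).
  have -> : c * #|B|%:R * K.[(k * l)%:R] = \sum_(x in B) c * K.[(k * l)%:R].
    by rewrite sumr_const -[RHS]mulr_natr; ring.
  apply: ler_sum => x xB; rewrite comp_polyM (fcalcM _ _ _ fr).
  have -> : K.[(k * l)%:R] = \sum_y \sum_(j < n.+1) kap j * (nbcum adj j.*2 x y)%:R.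
    rewrite exchange_big horner_sum; apply: eq_bigr => j _ /=.
    by rewrite hornerCM horner_ball -big_distrr /= sum_nbcum.
  rewrite big_distrr; apply: ler_sum => y _ /=.
  have LK : L y x (K \Po 'X^2) = \sum_(j < n.+1) kap j * (nbcum adj j.*2 x y)%:R.
    rewrite fcalcC -[_ \Po _]/(comp_poly _ _) rmorph_sum fcalc_sum.
    apply: eq_bigr => j _; rewrite rmorphM /= comp_polyC fcalcZ.
    by rewrite fcalc_ball.
  have LP : L x y (P \Po 'X^2) =
      c * (nbcum adj n.*2 x y)%:R
      + ((nbcum adj n.+1.*2 x y)%:R - (nbcum adj n.*2 x y)%:R).
    rewrite /P /endpolyX /endpoly comp_polyD comp_polyM -polyC1 -polyCB comp_polyC.
    by rewrite fcalcD fcalcZ !fcalc_ball //; ring.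
  rewrite LK LP mulrDl; set T := \sum_(j < _) _.
  have T0 : 0 <= T by apply: sumr_ge0 => j _; rewrite mulr_ge0.
  apply: (@le_trans _ _ (c * (nbcum adj n.*2 x y)%:R * T)); last first.
    by rewrite lerDl mulr_ge0 // subr_ge0 ler_nat nbcum_mono.
  (* Integrality enters here: for natural numbers a <= b one has a <= b a, since b >= 1 unless a =
     0. *)
  rewrite -mulrA ler_pM2l // big_distrr; apply: ler_sum => j _ /=.
  rewrite mulrCA ler_wpM2l // -natrM ler_nat.
  have := nbcum_mono j n x y; rewrite -ltnS ltn_ord => /(_ isT).
  by case: (nbcum adj j.*2 x y) => // m; case: (nbcum adj n.*2 x y) => // m' _; rewrite leq_pmull.
rewrite ler_pdivlMr // mulrC -(ler_pM2r Kkl) -horner_endpolyX.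
exact: le_trans low up.
Qed.

(** The polynomial 1 is admissible in [trace_bound], and the trace of the identity over [B] is the
    size of [B]. *)
Lemma part_le1 (theta : R) :
  (forall i j, theta < d i -> theta < d j -> i = j) -> theta < 0 ->
  (#|B| <= 1)%N.
Proof.
move=> uniq th0; have [->|[x0 x0B]] := set_0Vmem B; first by rewrite cards0.
have := trace_bound 1 theta x0 uniq (lt_trans th0 s_gt0).
rewrite hornerC comp_polyC => h; rewrite -(@ler_nat R); apply: le_trans (h _) => [|x xth].
  rewrite -sum1_card natr_sum; apply: ler_sum => x _.
  by rewrite (fcalc1 _ _ _ fr) eqxx.
by have := le_lt_trans xth th0; rewrite ltNge normr_ge0.
Qed.

End SemiregularGraph.

(** * The bound *)

(** In the degenerate cases the size of [B] is bounded by ball_0 or ball_1 at kl; this compares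
    these values with the claimed bound. *)
Lemma ball_le_endpoly {R : rcfType} (k l i n : nat) (c : R) :
  (0 < k)%N -> (0 < l)%N -> 0 < c -> (i <= n)%N ->
  ball k l (k * l)%:R i <= endpoly k l n c (k * l)%:R / c.
Proof.
move=> k0 l0 c0 /subnKC <-; rewrite ler_pdivlMr // mulrC.
have step j := ball_ge k l k0 l0 ((k * l)%:R : R) j (lexx _).
apply: (@le_trans _ _ (c * ball k l (k * l)%:R (i + (n - i)))).
  rewrite ler_pM2l //; elim: (n - i)%N => [|m IH]; first by rewrite addn0.
  by rewrite addnS; apply: le_trans IH _; have /andP[] := step (i + m)%N.
by rewrite /endpoly; have /andP[_] := step (i + (n - i))%N; lra.
Qed.

Lemma semiregular_part_bound {R : realType} (k l n : nat) (c theta : R)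
    (V : finType) (adj : rel V) (B : {set V}) :
  (0 < k)%N -> (0 < l)%N -> 0 < c ->
  second_largest_eigenvalue (Bmx k l (2 * n.+2)%N c) theta ->
  semiregular_bipartite k l adj B -> second_eigenvalue_le adj theta ->
  #|B|%:R <= endpoly k l n c (k * l)%:R / c.
Proof.
move=> k0 l0 c0 th sr [lam lamA lamth].
have [ths throot] := second_largest_Bmx _ _ _ _ _ k0 l0 c0 th.
have adjC : symmetric adj by case: sr.
have [d [u [fr chiE]]] := @adjacency_eigenframe R V adj adjC.
have uniq tau : theta <= tau -> forall i j, tau < d i -> tau < d j -> i = j.
  move=> thtau i j hi hj; have lamtau := le_trans lamth thtau.
  by apply: (second_largest_unique_above _ _ _ _ chiE lamA);
    [exact: le_lt_trans hi | exact: le_lt_trans hj].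
have ltsq (tau : R) : 0 <= tau -> tau < Num.sqrt (k * l)%:R -> tau ^+ 2 < (k * l)%:R.
  move=> tau0 taus; rewrite -[ltRHS]sqr_sqrtr ?ler0n //.
  by rewrite ltrXn2r // nnegrE sqrtr_ge0.
have s0 : 0 < Num.sqrt (k * l)%:R :> R by rewrite sqrtr_gt0 ltr0n muln_gt0 k0.
have bound tau n' c' : theta <= tau -> 0 <= tau -> tau < Num.sqrt (k * l)%:R ->
    0 < c' -> endpoly k l n' c' (tau ^+ 2) = 0 ->
    (forall j, (j <= n')%N -> 0 < ball k l (tau ^+ 2) j) ->
    #|B|%:R <= endpoly k l n' c' (k * l)%:R / c'.
  move=> thtau tau0 taus c'0 e bpos.
  apply: (part_bound _ _ _ _ k0 l0 sr _ _ _ fr n' c' (tau ^+ 2) tau) => //.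
    exact: uniq.
  exact: ltsq.
have [generic|] := boolP ((n == 0%N) || ((1 < k) && (1 < l))%N).
  have [mu [mu0 mupos bpos]] := @largest_root R k l n c generic.
  have mukl : mu < (k * l)%:R.
    by rewrite ltNge; apply/negP => /(endpoly_gt0 _ _ k0 l0 n _ _ c0); rewrite mu0 ltxx.
  have thmu : 0 <= theta -> theta ^+ 2 <= mu.
    move=> th0; case: throot => e.
      by have := ltsq _ th0 ths; rewrite e ltxx.
    by rewrite leNgt; apply/negP => /mupos; rewrite e ltxx.
  (* For mu >= 0 the threshold sqrt(mu) >= theta replaces theta, which may itself be negative. For
     mu < 0 theta must be negative, and [B] has at most one vertex. *)
  have [mu_ge0|mu_lt0] := leP 0 mu.
    apply: (bound (Num.sqrt mu)); rewrite ?sqr_sqrtr ?sqrtr_ge0 //.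
    - have [th0|th0] := leP 0 theta; last by rewrite ltW // (lt_le_trans th0) ?sqrtr_ge0.
      by rewrite -[leLHS]ger0_norm // -sqrtr_sqr ler_wsqrtr // thmu.
    - by rewrite ltr_sqrt // ltr0n muln_gt0 k0.
    - by move=> j jn; apply: bpos.
  have th0 : theta < 0.
    by rewrite ltNge; apply/negP => /thmu /le_lt_trans/(_ mu_lt0); rewrite ltNge sqr_ge0.
  have := part_le1 _ _ _ _ k0 l0 sr _ _ _ fr _ (uniq _ (lexx _)) th0.
  rewrite -(@ler_nat R) => /le_trans; apply.
  by have := @ball_le_endpoly R k l 0 n c k0 l0 c0 (leq0n _); rewrite ball0.
rewrite negb_or negb_and -!leqNgt => /andP[nN0 kl1].
have [l1|l1] := leqP l 1.
  have l1E : l = 1%N by apply/eqP; rewrite eqn_leq l1 l0.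
  (* For l = 1 take n' = 0 and c' = k - tau^2: then [endpoly] is x - tau^2, and the resulting bound
     is 1. *)
  set tau := Num.max theta 0.
  have tau0 : 0 <= tau by rewrite le_max lexx orbT.
  have taus : tau < Num.sqrt (k * l)%:R by rewrite gt_max ths s0.
  have c'0 : 0 < k%:R - tau ^+ 2.
    by rewrite subr_gt0; have := ltsq _ tau0 taus; rewrite l1E muln1.
  apply: le_trans (ball_le_endpoly k l 0 n c k0 l0 c0 (leq0n _)).
  have -> : ball k l (k * l)%:R 0
      = endpoly k l 0 (k%:R - tau ^+ 2) (k * l)%:R / (k%:R - tau ^+ 2) :> R.
    apply: (mulIf (lt0r_neq0 c'0)); rewrite divfK ?lt0r_neq0 //.
    by rewrite /endpoly ball1 ball0 l1E muln1; ring.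
  apply: (bound tau) => //; first by rewrite le_max lexx.
    by rewrite /endpoly ball1 ball0; ring.
  by move=> j; rewrite leqn0 => /eqP ->; rewrite ball0.
have k1E : k = 1%N.
  by apply/eqP; rewrite eqn_leq k0 andbT; case/orP: kl1 => //; rewrite leqNgt l1.
(* For k = 1 take n' = 1 and c' = l - tau^2: then [endpoly] is x (x - tau^2), and the resulting
   bound is l. The maximum with 1 makes ball_1(tau^2) = tau^2 positive. *)
set tau := Num.max theta 1.
have tau1 : 1 <= tau by rewrite le_max lexx orbT.
have tau0 : 0 <= tau by apply: le_trans tau1.
have taus : tau < Num.sqrt (k * l)%:R.
  by rewrite gt_max ths -[ltLHS]sqrtr1 ltr_sqrt ?ltr0n ?muln_gt0 ?k0 // ltr1n k1E mul1n.
have c'0 : 0 < l%:R - tau ^+ 2.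
  by rewrite subr_gt0; have := ltsq _ tau0 taus; rewrite k1E mul1n.
apply: le_trans (ball_le_endpoly k l 1 n c k0 l0 c0 _); last by rewrite lt0n.
have -> : ball k l (k * l)%:R 1
    = endpoly k l 1 (l%:R - tau ^+ 2) (k * l)%:R / (l%:R - tau ^+ 2) :> R.
  apply: (mulIf (lt0r_neq0 c'0)); rewrite divfK ?lt0r_neq0 //.
  by rewrite /endpoly ballSS ball1 ball0 k1E mul1n; ring.
apply: (bound tau) => //; first by rewrite le_max lexx.
  by rewrite /endpoly ballSS ball1 ball0 k1E; ring.
by case=> [|[|j]] // _; rewrite ?ball1 ?ball0 // k1E subrK exprn_gt0 // (lt_le_trans ltr01).
Qed.

Theorem theorem7p2 (R : realType) (k l t : nat) (c theta : R)
    (k_gt0 : (0 < k)%N) (l_gt0 : (0 < l)%N) (t_ge2 : (2 <= t)%N)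
    (c_gt0 : 0 < c)
    (theta_def : second_largest_eigenvalue (Bmx k l (2 * t)%N c) theta) :
  let bound : R :=
    1 + k%:R * (\sum_(1 <= i < (t - 2).+1)
                   (l%:R - 1) ^+ i * (k%:R - 1) ^+ (i - 1))
      + k%:R * (l%:R - 1) ^+ (t - 1) * (k%:R - 1) ^+ (t - 2) / c in
  (forall (V : finType) (adj : rel V) (B : {set V}),
     semiregular_bipartite k l adj B ->
     second_eigenvalue_le adj theta ->
     #|B|%:R <= bound)
  /\ (forall n : nat, is_b k l theta n -> n%:R <= bound).
Proof.
case: t t_ge2 theta_def => [|[|n]] // _ theta_def.
have -> : (n.+2 - 2 = n)%N by rewrite !subSS subn0.
have -> : (n.+2 - 1 = n.+1)%N by rewrite subn1.
move=> bound.
have main (V : finType) (adj : rel V) (B : {set V}) :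
    semiregular_bipartite k l adj B -> second_eigenvalue_le adj theta ->
    #|B|%:R <= bound.
  rewrite /bound -endpoly_bound //; exact: semiregular_part_bound.
split=> // m [[V [adj [B [sr sec <-]]]] _]; exact: main sr sec.
Qed.
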